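(* Let $\mathbb{F}$ be a commutative field and $r\ge 1$ an integer. Let $\langle\cdot,\cdot\rangle:\mathbf{D}'\times\mathbf{A}'\to\mathbb{F}$ be the bilinear mapping $\langle d(X),W(Y)\rangle=\sum_{\alpha\in\mathbb{Z}^r}d_\alpha W_\alpha$. Then: (1) The homomorphisms (of $\mathbb{F}$-vector spaces) $$\mathbf{D}'\to\operatorname{Hom}_{\mathbb{F}}(\mathbf{A}',\mathbb{F}),\quad d(X)\mapsto\langle d(X),\cdot\rangle,$$ $$\mathbf{A}'\to\operatorname{Hom}_{\mathbb{F}}(\mathbf{D}',\mathbb{F}),\quad W(Y)\mapsto\langle\cdot,W(Y)\rangle,$$ are injective. (2) The latter homomorphism, $\mathbf{A}'\to\operatorname{Hom}_{\mathbb{F}}(\mathbf{D}',\mathbb{F})$, is an isomorphism.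
   Context: $\mathbf{D}'=\mathbb{F}[X_1,X_1^{-1},\dots,X_r,X_r^{-1}]$ is the ring of Laurent polynomials, with elements $d(X)=\sum_{\alpha\in\mathbb{Z}^r}d_\alpha X^\alpha$, where $d_\alpha\in\mathbb{F}$ and only finitely many $d_\alpha$ are nonzero; here $X^\alpha=X_1^{\alpha_1}\cdots X_r^{\alpha_r}$ for $\alpha=(\alpha_1,\dots,\alpha_r)\in\mathbb{Z}^r$. $\mathbf{A}'=\mathbb{F}[[Y_1,Y_1^{-1},\dots,Y_r,Y_r^{-1}]]$ is the $\mathbb{F}$-vector space of all formal two-sided (bi-infinite) Laurent series $W(Y)=\sum_{\alpha\in\mathbb{Z}^r}W_\alpha Y^\alpha$ with arbitrary coefficients $W_\alpha\in\mathbb{F}$ (no restriction on the support), where $Y^\alpha=Y_1^{\alpha_1}\cdots Y_r^{\alpha_r}$; addition and scalar multiplication are coefficientwise. $\operatorname{Hom}_{\mathbb{F}}(V,\mathbb{F})$ denotes the space of all $\mathbb{F}$-linear maps $V\to\mathbb{F}$. *)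

(* Defs.v *)
From HB Require Import structures.
From mathcomp Require Import all_boot all_algebra.
From mathcomp Require Import finmap.
From mathcomp Require Import boolp functions.
From mathcomp.multinomials Require Import monalg.

Set Implicit Arguments.
Unset Strict Implicit.
Unset Printing Implicit Defensive.
Set Warnings "-redundant-canonical-projection".

Import GRing.Theory.
Local Open Scope ring_scope.

(* Hom_F(V, F), with its pointwise F-vector space structure. *)
Section Dual.
Variables (F : fieldType) (V : lmodType F).

Definition dual := {scalar V}.

Definition dual_fun (f : dual) : V -> F := f.

HB.instance Definition _ := gen_eqMixin dual.
HB.instance Definition _ := gen_choiceMixin dual.

Lemma dual_ext (f g : dual) : dual_fun f =1 dual_fun g -> f = g.
Proof.
case: f g => [f [[fD] [fZ]]] [g [[gD] [gZ]]] /funext fg.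
rewrite /dual_fun /= in fg; subst g.
by rewrite (Prop_irrelevance fD gD) (Prop_irrelevance fZ gZ).
Qed.

Definition dual_zero : dual := (\0 : V -> F).
Definition dual_add (f g : dual) : dual := f \+ g.
Definition dual_opp (f : dual) : dual := \- f.

Definition dual_scale_fun (a : F) (f : dual) (v : V) : F := a * f v.

Fact dual_scale_scalar (a : F) (f : dual) : scalar (dual_scale_fun a f).
Proof.
by move=> b u v; rewrite /dual_scale_fun linearP /= mulrDr mulrCA.
Qed.

HB.instance Definition _ (a : F) (f : dual) :=
  GRing.isLinear.Build F V F *%R (dual_scale_fun a f) (dual_scale_scalar a f).

Definition dual_scale (a : F) (f : dual) : dual := dual_scale_fun a f.

Lemma dual_addA : associative dual_add.
Proof. by move=> f g h; apply: dual_ext => v; exact: addrA. Qed.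

Lemma dual_addC : commutative dual_add.
Proof. by move=> f g; apply: dual_ext => v; exact: addrC. Qed.

Lemma dual_add0 : left_id dual_zero dual_add.
Proof. by move=> f; apply: dual_ext => v; exact: add0r. Qed.

Lemma dual_addN : left_inverse dual_zero dual_opp dual_add.
Proof. by move=> f; apply: dual_ext => v; exact: addNr. Qed.

HB.instance Definition _ :=
  GRing.isZmodule.Build dual dual_addA dual_addC dual_add0 dual_addN.

Lemma dual_scaleA (a b : F) (f : dual) :
  dual_scale a (dual_scale b f) = dual_scale (a * b) f.
Proof. by apply: dual_ext => v; exact: mulrA. Qed.

Lemma dual_scale1 : left_id 1 dual_scale.
Proof. by move=> f; apply: dual_ext => v; exact: mul1r. Qed.

Lemma dual_scaleDr : right_distributive dual_scale +%R.
Proof. by move=> a f g; apply: dual_ext => v; exact: mulrDr. Qed.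

Lemma dual_scaleDl (f : dual) : {morph dual_scale^~ f : a b / a + b}.
Proof. by move=> a b; apply: dual_ext => v; exact: mulrDl. Qed.

HB.instance Definition _ :=
  GRing.Zmodule_isLmodule.Build F dual
    dual_scaleA dual_scale1 dual_scaleDr dual_scaleDl.

End Dual.

Section DualMaps.
Variables (F : fieldType) (U V : lmodType F).
Variable B : {bilinear U -> V -> F | *%R & *%R}.

Definition form_dual_l (u : U) : dual V := B u.

Definition form_dual_r (v : V) : dual U := applyr B v.

Lemma form_dual_l_linear : linear form_dual_l.
Proof. by move=> a u u'; apply: dual_ext => v; exact: linearPl. Qed.

Lemma form_dual_r_linear : linear form_dual_r.
Proof. by move=> a v v'; apply: dual_ext => u; exact: linearPr. Qed.

HB.instance Definition _ :=
  GRing.isLinear.Build F U (dual V) *:%R form_dual_l form_dual_l_linear.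

HB.instance Definition _ :=
  GRing.isLinear.Build F V (dual U) *:%R form_dual_r form_dual_r_linear.

End DualMaps.

Section Laurent.
Variables (F : fieldType) (r : nat).

Definition exponent := {ffun 'I_r -> int}.

(* Finitely supported families of coefficients: [d@_a] is the coefficient of
   X^a.  Multinomials puts a ring structure on [{malg F[K]}] only for monoids K
   without nontrivial units, so Z^r is not covered and this is the underlying
   F-vector space of the ring of Laurent polynomials. *)
Definition laurent_poly := {malg F[exponent]}.
HB.instance Definition _ := GRing.Lmodule.on laurent_poly.

Definition laurent_series := exponent -> F.
HB.instance Definition _ :=
  GRing.Lmodule.copy laurent_series (exponent -> F^o).

(* The summand is nonzero only on the finite support of [d]. *)
Definition pairing (d : laurent_poly) (W : laurent_series) : F :=
  \sum_(a <- msupp d) d@_a * W a.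

Lemma pairing_linear_l (W : laurent_series) : scalar (pairing^~ W).
Proof.
move=> c d d'.
have pE (E : {fset exponent}) (g : laurent_poly) :
    (msupp g `<=` E)%fset -> pairing g W = \sum_(a <- E) g@_a * W a.
  by move=> gE; exact: (mmapEw (f := idfun) gE).
rewrite (pE (msupp d `|` msupp d')%fset).
  rewrite (pE (msupp d `|` msupp d')%fset d) ?fsubsetUl //.
  rewrite (pE (msupp d `|` msupp d')%fset d') ?fsubsetUr //.
  rewrite mulr_sumr -big_split /=; apply: eq_bigr => a _.
  by rewrite mcoeffD mcoeffZ mulrDl mulrA.
apply: fsubset_trans (msuppD_le _ _) _.
by apply: fsetSU; exact: msuppZ_le.
Qed.

Lemma pairing_linear_r (d : laurent_poly) : scalar (pairing d).
Proof.
move=> c W W'; rewrite /pairing mulr_sumr -big_split /=.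
by apply: eq_bigr => a _; rewrite mulrDr mulrCA.
Qed.

HB.instance Definition _ :=
  bilinear_isBilinear.Build F laurent_poly laurent_series F *%R *%R pairing
    (pairing_linear_l, pairing_linear_r).

Definition poly_to_dual : {linear laurent_poly -> dual laurent_series} :=
  form_dual_l pairing.

Definition series_to_dual : {linear laurent_series -> dual laurent_poly} :=
  form_dual_r pairing.

End Laurent.

(* Main.v *)
Require Import Defs.
From mathcomp Require Import all_boot all_algebra.
From mathcomp Require Import finmap boolp.
From mathcomp.multinomials Require Import monalg.

Set Implicit Arguments.
Unset Strict Implicit.
Unset Printing Implicit Defensive.

Import GRing.Theory.
Local Open Scope ring_scope.

Section Pairing.
Variables (F : fieldType) (r : nat).

(** The monomials X^a form a basis of the Laurent polynomials, so a linear functional on them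
    amounts to an arbitrary family of values on this basis. Series have unrestricted support, so
    such a family is exactly a series: [dual_to_series] inverts [series_to_dual]. In the other
    direction, testing against the series Y^a recovers each coefficient of d, whence
    [poly_to_dual_inj]. *)

Definition laurent_monom (a : exponent r) : laurent_poly F r := << a >>.

Definition series_monom (a : exponent r) : laurent_series F r :=
  fun b => (b == a)%:R.

Lemma laurent_polyE (d : laurent_poly F r) :
  d = \sum_(a <- msupp d) d@_a *: laurent_monom a.
Proof.
rewrite {1}[d]monalgE; apply: eq_bigr => a _.
by apply/malgP => b; rewrite mcoeffZ !mcoeffU mulr_natr.
Qed.

Lemma pairing_series_monom (d : laurent_poly F r) (a : exponent r) :
  pairing d (series_monom a) = d@_a.
Proof.
rewrite /pairing /series_monom; have [ad|ad] := boolP (a \in msupp d).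
  rewrite (big_fsetD1 a) //= eqxx mulr1 big_seq big1 ?addr0 // => b.
  by rewrite in_fsetD1 => /andP[/negPf-> _]; rewrite mulr0.
(* Off the support of [d], both sides vanish. *)
rewrite mcoeff_outdom // big_seq big1 // => b bd.
by case: eqP => [ba|_]; [rewrite -ba bd in ad | rewrite mulr0].
Qed.

Lemma pairing_laurent_monom (a : exponent r) (W : laurent_series F r) :
  pairing (laurent_monom a) W = W a.
Proof.
(* As 1 is nonzero in a field, the support is exactly the singleton of [a]. *)
by rewrite /pairing msuppU oner_eq0 big_seq_fset1 mcoeffU eqxx mul1r.
Qed.

Definition dual_to_series (f : dual (laurent_poly F r)) : laurent_series F r :=
  fun a => f (laurent_monom a).

Lemma series_to_dualK : cancel (series_to_dual F r) dual_to_series.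
Proof. by move=> W; apply/funext => a; exact: pairing_laurent_monom. Qed.

Lemma dual_to_seriesK : cancel dual_to_series (series_to_dual F r).
Proof.
move=> f; apply: dual_ext => d.
(* Only the right-hand [d] is expanded: the left side already unfolds to a sum over [msupp d], so
   the terms match by homogeneity of [f]. *)
rewrite /dual_fun [in RHS](laurent_polyE d) linear_sum.
by apply: eq_bigr => a _; rewrite linearZ.
Qed.

Lemma poly_to_dual_inj : injective (poly_to_dual F r).
Proof.
move=> d d' dd'; apply/malgP => a; rewrite -!pairing_series_monom.
exact: (congr1 (fun f : dual (laurent_series F r) => f (series_monom a)) dd').
Qed.

End Pairing.

Theorem proposition3p1 (F : fieldType) (r : nat) (r_ge1 : (1 <= r)%N) :
  (injective (poly_to_dual F r) /\ injective (series_to_dual F r)) /\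
  bijective (series_to_dual F r).
Proof.
split; last exact: Bijective (@series_to_dualK F r) (@dual_to_seriesK F r).
split; [exact: poly_to_dual_inj | exact: can_inj (@series_to_dualK F r)].
Qed.
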